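(* Let $n\ge 1$ be an integer and let $x,y$ be complex numbers such that no denominator below vanishes, i.e. $x\notin\{-1,\dots,-n\}$ and $y\notin\{-n,-n+1,\dots,n-1\}$. Then $$\sum_{k=0}^n(-1)^k\binom{n}{k}\frac{\binom{y+k}{k}}{\binom{y-n+k}{k}}\frac{y}{y+k}H_{k}(x)=\frac{(-1)^n}{n}\,\frac{1}{\binom{y}{n}}\bigg\{1-\frac{\binom{x-y+n}{n}}{\binom{x+n}{n}}\bigg\}.$$
   Context: For a complex number $u$ and an integer $k\ge 0$, $\binom{u}{k}=\frac{u(u-1)\cdots(u-k+1)}{k!}$ (equal to $1$ for $k=0$). For a complex number $u$, the generalized harmonic numbers are $H_0(u)=0$ and $H_n(u)=\sum_{k=1}^n\frac{1}{u+k}$ for $n\ge1$. *)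

(* Defs.v *)
From mathcomp Require Import all_boot all_order all_algebra.
From mathcomp Require Import reals.
From mathcomp Require Import complex.

Set Implicit Arguments.
Unset Strict Implicit.
Unset Printing Implicit Defensive.

Import Order.TTheory GRing.Theory Num.Theory.

Local Open Scope ring_scope.

(* Meaningful only when k! is nonzero in F, e.g. in characteristic 0. *)
Definition gbinom (F : fieldType) (u : F) (k : nat) : F :=
  (\prod_(i < k) (u - i%:R)) / k`!%:R.

Definition gharmonic (F : fieldType) (n : nat) (u : F) : F :=
  \sum_(1 <= k < n.+1) (u + k%:R)^-1.

(* Main.v *)
Require Import Defs.
From mathcomp Require Import all_boot all_order all_algebra.
From mathcomp Require Import reals.
From mathcomp Require Import complex.
From mathcomp Require Import ring zify.

Import Order.TTheory GRing.Theory Num.Theory.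
Local Open Scope ring_scope.

(* The coefficient of H_k(x) is a difference S_k - S_(k-1), where S_k is
   (-1)^k C(n-1,k) C(y+k,k) / C(y-n+k,k), and S_n = 0 because C(n-1,n) = 0.
   Summation by parts turns the left-hand side into - sum_(k<n) S_k / (x+k+1),
   which is the partial fraction decomposition of the right-hand side in x. *)

Definition falling {F : fieldType} (u : F) (k : nat) : F :=
  \prod_(i < k) (u - i%:R).

Lemma fallingS {F : fieldType} (u : F) k :
  falling u k.+1 = falling u k * (u - k%:R).
Proof. by rewrite /falling big_ord_recr. Qed.

Lemma fallingSl {F : fieldType} (u : F) k :
  falling (u + 1) k.+1 = (u + 1) * falling u k.
Proof.
rewrite /falling big_ord_recl subr0; congr (_ * _).
by apply: eq_bigr => i _; rewrite lift0 -natr1; ring.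
Qed.

Lemma fallingD {F : fieldType} (u : F) a b :
  falling u (a + b) = falling u a * falling (u - a%:R) b.
Proof.
elim: b => [|b IH]; first by rewrite addn0 /falling big_ord0 mulr1.
by rewrite addnS !fallingS IH natrD; ring.
Qed.

Lemma falling_neq0 {F : fieldType} (u : F) k :
  (forall i, (i < k)%N -> u != i%:R) -> falling u k != 0.
Proof. by move=> hu; apply/prodf_neq0 => i _; rewrite subr_eq0 hu. Qed.

Lemma falling_rising {F : fieldType} (u : F) n :
  falling (u + n%:R) n = \prod_(i < n) (u + i.+1%:R).
Proof.
rewrite [RHS](reindex_inj rev_ord_inj); apply: eq_bigr => i _ /=.
by rewrite subnSK // natrB 1?ltnW //; ring.
Qed.

Lemma falling_opp {F : fieldType} (u : F) n :
  (-1) ^+ n * falling u n = \prod_(i < n) (i%:R - u).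
Proof.
rewrite -[X in _ ^+ X]card_ord -prodr_const -big_split /=.
by apply: eq_bigr => i _; ring.
Qed.

(** The indices below [m] give the signed factorial of [m], those above give the factorial of [r].
    These products are the Lagrange denominators for equally spaced nodes; counting the nodes as
    [m + r.+1] avoids truncated subtraction. *)
Lemma prod_node_gaps {F : fieldType} m r :
  \prod_(i < m + r.+1 | i != m :> nat) (i%:R - m%:R)
    = (-1) ^+ m * m`!%:R * r`!%:R :> F.
Proof.
rewrite -(big_mkord (fun i => i != m) (fun i => i%:R - m%:R : F)).
rewrite (big_cat_nat (leq0n m) (leq_addr r.+1 m)) /=.
rewrite (big_ltn_cond (m := m)) ?addnS ?ltnS ?leq_addr // eqxx /=.
congr (_ * _).
  (* Reversing the order makes the factors below [m] equal to -1, -2, ..., -m. *)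
  rewrite big_nat_rev fact_prod natr_prod /= add0n.
  rewrite -[X in _ ^+ X]subn0 -prodr_const_nat (big_add1 _ _ 0 m.+1) /=.
  rewrite -big_split /= big_nat_cond [RHS]big_nat_cond.
  apply: eq_big => i; first by case: ltnP => //= ltim;
    rewrite ltn_eqF // ltn_subrL (leq_ltn_trans _ ltim).
  move=> /andP[/andP[_ lim] _]; rewrite natrB //; ring.
rewrite fact_prod natr_prod (big_add1 _ _ 0 r.+1) /=.
rewrite -{1}[m.+1]add0n -addSn [(m.+1 + r)%N]addnC big_addn addnK.
rewrite big_nat_cond [RHS]big_nat_cond.
apply: eq_big => i; first by rewrite addnS gtn_eqF ?ltnS ?leq_addl.
by move=> _; rewrite addnS -addSn natrD addrK.
Qed.

(* Lagrange interpolation at the nodes -(j+1) of the difference of the two monic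
   numerators, which has degree less than n. *)
Lemma partial_fractions {F : numFieldType} n (x y : F) : (0 < n)%N ->
  (forall i : 'I_n, x + i.+1%:R != 0) ->
  \sum_(j < n) \prod_(i < n) (i%:R - j%:R - y)
      / \prod_(i < n | i != j :> nat) (i%:R - j%:R) / (x + j.+1%:R)
    = \prod_(i < n) (x - y + i.+1%:R) / \prod_(i < n) (x + i.+1%:R) - 1.
Proof.
move=> n0 hx.
pose a (i : nat) : F := - i.+1%:R.
have ainj : injective a by move=> i j /oppr_inj/eqP; rewrite eqr_nat => /eqP[].
(* At [x], [p y] is the numerator and [p 0] the denominator of the quotient. Since [p 0] vanishes at
   every node, only [p y] contributes to the interpolated values. *)
pose p (z : F) : {poly F} := \prod_(i < n) ('X - (a i + z)%:P).
have pE z t : (p z).[t] = \prod_(i < n) (t - z + i.+1%:R).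
  by rewrite horner_prod; apply: eq_bigr => i _; rewrite !hornerE /a; ring.
have size_p z : size (p z) = n.+1.
  by rewrite size_prod_XsubC /index_enum -enumT size_enum_ord.
have size_pB : (size (p y - p 0)%R <= n)%N.
  apply/leq_sizeP => j; rewrite leq_eqVlt coefB => /predU1P[<-|ltnj].
    have lead z : (p z)`_n = 1.
      by rewrite -[n in _`_n]/n.+1.-1 -(size_p z) -lead_coefE;
        apply/monicP/monic_prod_XsubC.
    by rewrite !lead subrr.
  by rewrite !nth_default ?subrr ?size_p.
have D0 : \prod_(i < n) (x + i.+1%:R) != 0 by apply/prodf_neq0 => i _.
rewrite -[X in _ - X](divff D0) -mulrBl; apply: (canRL (mulfK D0)).
have := congr1 (horner^~ x) (lagrange_gen n0 ainj size_pB).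
rewrite hornerD hornerN !pE subr0 => ->.
rewrite mulr_suml horner_sum; apply: eq_bigr => j _.
have -> : (p y - p 0).[a j] = \prod_(i < n) (i%:R - j%:R - y).
  have p0_root : (p 0).[a j] = 0 by rewrite pE (bigD1 j) //= subr0 addNr mul0r.
  by rewrite hornerD hornerN p0_root subr0 pE;
    apply: eq_bigr => i _; rewrite /a -!natr1; ring.
rewrite hornerM hornerC lagrangeE //= hornerM hornerC !horner_prod.
(* The factor [x + j.+1%:R] of the common denominator cancels the simple pole; the other factors
   form the numerator of the Lagrange polynomial at node [j]. *)
rewrite (bigD1 j (F := fun i : 'I_n => x + i.+1%:R)) //= [_ / (x + _)]mulrC !mulrA.
rewrite [_ * (x + _)]mulrC !mulrA divff ?mul1r //.
congr (_ * _^-1 * _); apply: eq_bigr => i _; rewrite !hornerE /a ?opprK //.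
by rewrite -!natr1; ring.
Qed.

(** The hypotheses make [s] the sequence of partial sums of [t], with [t 0 = s 0] standing for a
    zero value of [s] at -1. *)
Lemma summation_by_parts {F : fieldType} (t s h : nat -> F) n :
  t 0 = s 0 -> (forall k, (k < n)%N -> t k.+1 = s k.+1 - s k) ->
  \sum_(0 <= k < n.+1) t k * h k
    = s n * h n - \sum_(k < n) s k * (h k.+1 - h k).
Proof.
move=> t0; elim: n => [|n IH] tS; first by rewrite big_nat1 big_ord0 subr0 t0.
rewrite big_nat_recr //= IH ?tS //; first by rewrite big_ord_recr /=; ring.
by move=> k ltkn; rewrite tS // ltnW.
Qed.

Lemma gharmonicS {F : fieldType} k (x : F) :
  gharmonic k.+1 x - gharmonic k x = (x + k.+1%:R)^-1.
Proof. by rewrite /gharmonic (big_nat_recr k.+1) //= addrAC subrr add0r. Qed.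

Lemma gbinom_rising {F : fieldType} (u : F) n :
  gbinom (u + n%:R) n = (\prod_(i < n) (u + i.+1%:R)) / n`!%:R.
Proof. by rewrite -falling_rising. Qed.

Lemma fact_neq0 {F : numFieldType} k : k`!%:R != 0 :> F.
Proof. by rewrite pnatr_eq0 -lt0n fact_gt0. Qed.

Definition binom_ratio {F : fieldType} (y : F) n k :=
  gbinom (y + k%:R) k / gbinom (y - n%:R + k%:R) k.

Lemma binom_ratio_falling {F : numFieldType} (y : F) n k :
  binom_ratio y n k = falling (y + k%:R) k / falling (y - n%:R + k%:R) k.
Proof.
rewrite /binom_ratio /gbinom -!/(falling _ _) invfM invrK mulrACA.
by rewrite mulVf ?mulr1 // fact_neq0.
Qed.

Lemma binom_ratioS {F : numFieldType} (y : F) n k :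
  binom_ratio y n k.+1
    = (y + k.+1%:R) / (y - n%:R + k.+1%:R) * binom_ratio y n k.
Proof.
rewrite !binom_ratio_falling -!natr1 !addrA !fallingSl invfM.
by rewrite mulrACA.
Qed.

(** The product [falling (y + k%:R) (k + n)] splits by [fallingD] after [k] or after [n] factors;
    equating the two gives the claim. The denominator no longer depends on [k], and the numerator
    is, up to sign, that of a Lagrange weight. *)
Lemma binom_ratioE {F : numFieldType} (y : F) n k :
  falling y n != 0 -> falling (y - n%:R + k%:R) k != 0 ->
  binom_ratio y n k = falling (y + k%:R) n / falling y n.
Proof.
move=> y0 yk0; rewrite binom_ratio_falling; apply/eqP; rewrite eqr_div //.
have := fallingD (y + k%:R) k n; rewrite addrK => <-.
by rewrite addnC fallingD addrAC.
Qed.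

Lemma hypergeometric_telescope {F : numFieldType} (y : F) n k :
  (k <= n)%N -> y - n.+1%:R + k.+1%:R != 0 -> y + k.+1%:R != 0 ->
  (-1) ^+ k.+1 * 'C(n.+1, k.+1)%:R * binom_ratio y n.+1 k.+1
      * (y / (y + k.+1%:R))
    = (-1) ^+ k.+1 * 'C(n, k.+1)%:R * binom_ratio y n.+1 k.+1
      - (-1) ^+ k * 'C(n, k)%:R * binom_ratio y n.+1 k.
Proof.
move=> lekn d1 d2.
have /(congr1 (fun m => m%:R : F)) := mul_bin_left n k.
rewrite !natrM natrB // => binE.
rewrite binom_ratioS binS natrD exprS.
set a := 'C(n, k.+1)%:R in binE *; set b := 'C(n, k)%:R in binE *.
set r := binom_ratio y n.+1 k; set e := (-1) ^+ k.
apply/eqP; rewrite -subr_eq0; apply/eqP.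
(* With Pascal's rule applied and [y + k.+1%:R] cancelled, [y] drops out of the numerator, leaving
   the bracket that [binE] annihilates. *)
transitivity (e * r * (k.+1%:R * a - (n%:R - k%:R) * b) / (y - n.+1%:R + k.+1%:R)).
  by rewrite -!natr1 in d1 d2 *; field; rewrite d1 d2.
by rewrite binE subrr mulr0 mul0r.
Qed.

Theorem theorem8 (R : realType) (n : nat) (x y : R[i])
    (hn : (1 <= n)%N)
    (hx : forall j : nat, (1 <= j <= n)%N -> x != - j%:R)
    (hy : forall j : int, - n%:Z <= j <= n%:Z - 1 -> y != j%:~R) :
  \sum_(0 <= k < n.+1)
     (-1) ^+ k * 'C(n, k)%:R
     * (gbinom (y + k%:R) k / gbinom (y - n%:R + k%:R) k)
     * (y / (y + k%:R)) * gharmonic k x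
  = (-1) ^+ n / n%:R * (gbinom y n)^-1
    * (1 - gbinom (x - y + n%:R) n / gbinom (x + n%:R) n).
Proof.
(* The index of the statement becomes [n.+1], so the binomial coefficient in [s] below is
   ['C(n, k)]. *)
case: n hn hx hy => // n _ hx hy.
have yN i : (i < n.+1)%N -> y != i%:R.
  by move=> ltin; apply: (hy i%:Z); lia.
have yP k : (k < n.+1)%N -> y + k.+1%:R != 0.
  move=> ltkn; rewrite addr_eq0 -[k.+1%:R]/(k.+1%:Z%:~R) -mulrNz.
  apply: (hy (- k.+1%:Z)); lia.
have yB k : (k < n.+1)%N -> y - n.+1%:R + k.+1%:R != 0.
  move=> ltkn; rewrite -addrA [- _ + _]addrC -opprB subr_eq0 -natrB //; apply: yN.
  by rewrite ltn_subrL.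
have xP k : (k < n.+1)%N -> x + k.+1%:R != 0.
  by move=> ltkn; rewrite addr_eq0 hx.
have f0 : falling y n.+1 != 0 by apply: falling_neq0.
have ratioE k : (k < n.+1)%N ->
    binom_ratio y n.+1 k = falling (y + k%:R) n.+1 / falling y n.+1.
  move=> ltkn; apply: binom_ratioE f0 _; apply: falling_neq0 => i ltik.
  (* Factor [i] of the falling product is [y - n.+1%:R] plus [k - i], which is at least 1, so [yB]
     applies at the predecessor. *)
  have ltki : ((k - i).-1 < n.+1)%N by lia.
  have := yB _ ltki; rewrite prednK ?subn_gt0 // natrB; last exact: ltnW.
  by rewrite addrA subr_eq0.
pose s k := (-1) ^+ k * 'C(n, k)%:R * binom_ratio y n.+1 k.
rewrite -!/(binom_ratio _ _ _).
rewrite (eq_bigr (fun k => ((-1) ^+ k * 'C(n.+1, k)%:R * binom_ratio y n.+1 k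
  * (y / (y + k%:R))) * gharmonic k x)) //.
rewrite (summation_by_parts _ s); first last.
- by move=> k ltkn; apply: hypergeometric_telescope => //; [apply: yB | apply: yP].
- by rewrite /s !bin0 addr0 divff ?mulr1 //; exact: (yN 0).
rewrite {1}/s bin_small // mulr0 !mul0r sub0r.
have -> : gbinom (x - y + n.+1%:R) n.+1 / gbinom (x + n.+1%:R) n.+1
    = \prod_(i < n.+1) (x - y + i.+1%:R) / \prod_(i < n.+1) (x + i.+1%:R).
  by rewrite !gbinom_rising invf_div mulrA divfK // fact_neq0.
rewrite -opprB -partial_fractions // => [|i]; last exact: xP.
(* It remains to compare the coefficients of the simple fractions in [x], one [k] at a time. *)
rewrite mulrN mulr_sumr; congr (- _); apply: eq_bigr => k _.
have lekn : (k <= n)%N by rewrite -ltnS.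
have gapsE := @prod_node_gaps R[i] k (n - k); rewrite addnS subnKC // in gapsE.
have -> : \prod_(i < n.+1) (i%:R - k%:R - y)
    = (-1) ^+ n.+1 * falling (y + k%:R) n.+1.
  by rewrite falling_opp; apply: eq_bigr => i _; ring.
rewrite gapsE gharmonicS /s ratioE // /gbinom -/(falling _ _) factS natrM.
rewrite !mulrA; congr (_ / _).
have binE : 'C(n, k)%:R = n`!%:R / (k`!%:R * (n - k)`!%:R) :> R[i].
  by rewrite -(bin_fact lekn) -natrM natrM mulfK // natrM mulf_neq0 ?fact_neq0.
set N := n.+1 in f0 *; set e := (-1) ^+ k; set E := (-1) ^+ N.
have N0 : N%:R != 0 :> R[i] by rewrite pnatr_eq0.
have e0 : e != 0 by rewrite signr_eq0.
(* The left side carries [e], the right side [E ^+ 2 / e]. As [field] does not know that signs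
   square to 1, the factor [E ^+ 2 / e ^+ 2] is inserted by hand. *)
transitivity (E ^+ 2 / e ^+ 2 * (e * 'C(n, k)%:R * falling (y + k%:R) N / falling y N)).
  by rewrite !sqrr_sign divr1 mul1r.
rewrite binE; field.
by rewrite f0 e0 N0 !fact_neq0.
Qed.
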